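(* If $S_0^+=S_0$ or $k=1$, then the inequality $$w\le\sum_{i\in S_0}\zeta(a_i)x_i+\sum_{i\in S_1}\eta(-a_i)(\mu_i-x_i)+\rho_s(k)(x_s-k)+g(ka_s)$$ is facet-defining for $\operatorname{conv}(\mathcal{X})$.
   Context: Let $n\ge 1$, let $f:\mathbb{R}\to\mathbb{R}$ be concave, let $a\in\mathbb{R}^n$ with $a_i\ge 0$ for all $i$, and let $\mu\in\mathbb{Z}^n$ with all $\mu_i\ge 1$. Define $$\mathcal{X}=\{(w,x)\in\mathbb{R}\times\mathbb{Z}^n : w\le f(a^\top x),\ 0\le x_i\le\mu_i\ \text{for } i=1,\dots,n\}.$$ Fix $s\in\{1,\dots,n\}$ with $a_s>0$, disjoint subsets $S_0,S_1$ of $\{1,\dots,n\}\setminus\{s\}$ with $\{s\}\cup S_0\cup S_1=\{1,\dots,n\}$, and an integer $k\in\{1,\dots,\mu_s\}$. Define $g(z)=f\big(z+\sum_{i\in S_1}\mu_i a_i\big)$, $\rho_s(k)=g(ka_s)-g((k-1)a_s)$, $$\zeta(\delta)=\max\big\{g(\delta+a_s x)-\rho_s(k)(x-k)-g(ka_s) : x\in\mathbb{Z},\ 0\le x\le\mu_s\big\}\quad(\delta\in\mathbb{R}),$$ $S_0^+=\{i\in S_0 : a_i\ge ka_s\}$, and, for $\delta\le 0$, $$\eta(\delta)=\max\Big\{g\Big(\delta+\sum_{i\in S_0\cup\{s\}}a_ix_i\Big)-\sum_{i\in S_0}\zeta(a_i)x_i+(k-x_s)\rho_s(k)-g(ka_s)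 : x_i\in\mathbb{Z},\ 0\le x_i\le\mu_i\ \forall\, i\in S_0\cup\{s\}\Big\}.$$ A linear inequality is facet-defining for a polyhedron $P$ if it is valid for $P$ and the set of points of $P$ satisfying it with equality is a face of dimension $\dim P-1$. *)

(* Defs.v *)
From HB Require Import structures.
From mathcomp Require Import all_boot all_order all_algebra.
From mathcomp Require Import archimedean.
From mathcomp Require Import boolp classical_sets reals convex.

Set Implicit Arguments.
Unset Strict Implicit.
Unset Printing Implicit Defensive.

Import Order.TTheory GRing.Theory Num.Theory.

Local Open Scope classical_set_scope.
Local Open Scope ring_scope.

Definition concave_function (R : realType) (f : R -> R) : Prop :=
  convex_function (setT : set (convex_lmodType R^o)) (fun x : R^o => - f x).

Section Polyhedra.
Context {R : realType} {V : lmodType R}.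

Definition convex_hull (A : set V) : set V := smallest (@convex_set R V) A.

Definition affinely_independent (m : nat) (p : 'I_m -> V) : Prop :=
  forall c : 'I_m -> R,
    \sum_j c j = 0 -> \sum_j c j *: p j = 0 -> forall j, c j = 0.

(* d is one less than the maximal number of affinely independent points of P;
   it is an int so that the empty set has dimension -1 *)
Definition has_dim (P : set V) (d : int) : Prop :=
  (exists m (p : 'I_m -> V),
     [/\ forall j, P (p j), affinely_independent p & d = m%:Z - 1]) /\
  (forall m (p : 'I_m -> V),
     (forall j, P (p j)) -> affinely_independent p -> m%:Z - 1 <= d).

(* The linear inequality is [lhs v <= rhs v], with lhs and rhs affine functions *)
Definition facet_defining (P : set V) (lhs rhs : V -> R) : Prop :=
  (forall v, P v -> lhs v <= rhs v) /\
  (exists d : int,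
     has_dim P d /\ has_dim [set v | P v /\ lhs v = rhs v] (d - 1)).

End Polyhedra.

Section Maximum.
Context {R : realType} {I : finType}.

(* i0 only witnesses that I is nonempty *)
Definition finmax (i0 : I) (F : I -> R) : R := F [arg max_(i > i0) F i]%O.

Lemma finmaxP (i0 : I) (F : I -> R) :
  (exists i, finmax i0 F = F i) /\ (forall i, F i <= finmax i0 F).
Proof.
rewrite /finmax; case: arg_maxP => // i _ Hi.
by split => [|j]; [exists i | exact: Hi].
Qed.

End Maximum.

Section MixedIntegerSet.
Context {R : realType} {n : nat}.
Implicit Types (a : 'rV[R]_n) (mu : 'I_n -> nat) (s : 'I_n) (k : nat).

Definition mixed_set (f : R -> R) a mu : set (R^o * 'rV[R]_n) :=
  [set p : R^o * 'rV[R]_n | p.1 <= f (\sum_i a 0 i * p.2 0 i) /\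
           forall i, p.2 0 i \is a Num.int /\ 0 <= p.2 0 i <= (mu i)%:R].

Definition shift_by (f : R -> R) a mu (S1 : {set 'I_n}) (z : R) : R :=
  f (z + \sum_(i in S1) (mu i)%:R * a 0 i).

Definition rho (g : R -> R) a s k : R :=
  g (k%:R * a 0 s) - g ((k%:R - 1) * a 0 s).

Definition zeta (g : R -> R) a mu s k (delta : R) : R :=
  finmax ord0 (fun x : 'I_(mu s).+1 =>
    g (delta + a 0 s * x%:R) - rho g a s k * (x%:R - k%:R)
    - g (k%:R * a 0 s)).

(* The maximum is over the whole box [0, mu], but the objective only involves
   the coordinates of x in S0 and s *)
Definition eta (g : R -> R) a mu s (S0 : {set 'I_n}) k (delta : R) : R :=
  finmax ([ffun i : 'I_n => ord0 : 'I_(mu i).+1] : {dffun forall i, 'I_(mu i).+1})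
   (fun x =>
    g (delta + \sum_(i in s |: S0) a 0 i * (x i)%:R)
    - \sum_(i in S0) zeta g a mu s k (a 0 i) * (x i)%:R
    + (k%:R - (x s)%:R) * rho g a s k
    - g (k%:R * a 0 s)).

Definition large_part a s (S0 : {set 'I_n}) k : {set 'I_n} :=
  [set i in S0 | k%:R * a 0 s <= a 0 i]%SET.

End MixedIntegerSet.

(* Main.v *)
(** Subtracting from [g] its chord over [[(k-1) a_s, k a_s]] gives a concave
    [phi] vanishing at both ends of that interval; put [Phi u = max_t phi (u + t
    a_s)] over [0 <= t <= mu_s]. Then [zeta] is [Phi] up to a linear term, and
    [eta] is, up to the same linear term, the best value of [Phi (delta + sum
    a_i x_i) - sum Phi (a_i) x_i]. Between its two ends [Phi] is the
    [a_s]-periodic extension of [phi] on [[(k-1) a_s, k a_s]], hence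
    subadditive, and beyond them it is concave, so it is subadditive on each
    half-line. For [b >= k a_s] moreover [Phi (b-u-v) + Phi b <= Phi (b-u) + Phi
    (b-v)] when [0 <= u, v <= b]. This allows an optimal solution for [eta
    (-d1-d2)] to be split into solutions for [eta (-d1)] and [eta (-d2)], so
    that [d |-> eta (-d)] is subadditive and the inequality is valid. Points
    attaining the maxima [zeta a_i], [eta (-a_i)], together with the two points
    [x_s = k] and [x_s = k-1], are [n+1] affinely independent points of
    equality. *)
Require Import Defs.
From mathcomp Require Import all_boot all_order all_algebra archimedean.
From mathcomp Require Import classical_sets reals convex interval_inference.
From mathcomp Require Import ring lra zify.

Set Implicit Arguments.
Unset Strict Implicit.
Unset Printing Implicit Defensive.

Import Order.TTheory GRing.Theory Num.Theory.
Local Open Scope ring_scope.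

(** * Translates of a concave function *)

Lemma concave_functionP (R : realType) (f : R -> R) :
  concave_function f <->
  forall t x y, 0 <= t <= 1 ->
    t * f x + (1 - t) * f y <= f (t * x + (1 - t) * y).
Proof.
split=> [fc t x y /andP[t0 t1]|fc t x y _ _].
  have := fc (Itv01 t0 t1) x y (mem_set I) (mem_set I).
  rewrite [conv _ (- _ : R^o) _]convRE /= /conv /= /unstable.onem.
  by rewrite !mulrN -opprD lerN2.
rewrite [conv _ (- _ : R^o) _]convRE /= /conv /= /unstable.onem.
rewrite !mulrN -opprD lerN2; apply: fc.
by rewrite ge0 /=; apply: le1.
Qed.

(** The slope over [[x1, y2]] lies between the slopes over [[x1, x2]] and [[y1, y2]]; all is
    cross-multiplied to avoid quotients. *)
Lemma concave_slope (R : realType) (f : R -> R) (x1 x2 y1 y2 : R) :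
  concave_function f -> x1 < x2 -> y1 < y2 -> x1 <= y1 -> x2 <= y2 ->
  (f y2 - f y1) * (x2 - x1) <= (f x2 - f x1) * (y2 - y1).
Proof.
move=> /concave_functionP fc x12 y12 xy1 xy2.
have three x y z : x <= y -> y <= z -> x < z ->
    (z - y) * f x + (y - x) * f z <= (z - x) * f y.
  move=> xy yz xz; have zx : 0 < z - x by rewrite subr_gt0.
  have := fc ((z - y) / (z - x)) x z.
  rewrite ler_pdivrMr // mul1r lerD2l lerN2 xy divr_ge0 ?subr_ge0 ?(ltW xz) //.
  move=> /(_ isT).
  rewrite -(ler_pM2l zx) => H; apply: (le_trans (le_trans _ H)).
    by rewrite le_eqVlt; apply/orP; left; apply/eqP; field; rewrite gt_eqF.
  rewrite le_eqVlt; apply/orP; left; apply/eqP; congr (_ * f _).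
  by field; rewrite gt_eqF.
have H1 := three x1 x2 y2 (ltW x12) xy2 (lt_le_trans x12 xy2).
have H2 := three x1 y1 y2 xy1 (ltW y12) (le_lt_trans xy1 y12).
have x1y2 : 0 < y2 - x1 by rewrite subr_gt0 (lt_le_trans x12).
rewrite -(ler_pM2l x1y2).
have {}H1 : (y2 - y1) * ((x2 - x1) * (f y2 - f x1)) <=
            (y2 - y1) * ((y2 - x1) * (f x2 - f x1)).
  by apply: ler_wpM2l; [rewrite subr_ge0 ltW | nra].
have {}H2 : (x2 - x1) * ((y2 - x1) * (f y2 - f y1)) <=
            (x2 - x1) * ((y2 - y1) * (f y2 - f x1)).
  by apply: ler_wpM2l; [rewrite subr_ge0 ltW | nra].
lra.
Qed.

(** The intervals [[x, y1]] and [[y2, z]] have equal length and the second lies weakly to the right,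
    so [f] rises no more on it. *)
Lemma concave_majorize (R : realType) (f : R -> R) (x y1 y2 z : R) :
  concave_function f -> x <= y1 -> y1 <= z -> y1 + y2 = x + z ->
  f x + f z <= f y1 + f y2.
Proof.
move=> fc; rewrite le_eqVlt => /predU1P[<- _ /addrI -> //|xy1 y1z e].
have y2E : y2 = x + z - y1 by rewrite -e addrAC subrr add0r.
have := concave_slope fc xy1 (_ : y2 < z) _ y1z.
have -> : z - y2 = y1 - x by rewrite y2E; lra.
rewrite ler_pM2r ?subr_gt0 //; move=> /(_ _ _)H.
by have := H ltac:(lra) ltac:(lra); lra.
Qed.

(** This is the [Phi] of the outline: the coordinate [x_s] is maximized out. *)
Definition shift_max (R : realType) (phi : R -> R) (step : R) (mu : nat)
    (u : R) : R :=
  finmax ord0 (fun t : 'I_mu.+1 => phi (u + step * t%:R)).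

Section ShiftMax.
Context {R : realType} {phi : R -> R} {step : R} {k mu : nat}.

Lemma shift_max_ge (t : nat) (u : R) :
  (t <= mu)%N -> phi (u + step * t%:R) <= shift_max phi step mu u.
Proof.
rewrite -ltnS => tm.
by have [_ /(_ (Ordinal tm))] :=
  finmaxP ord0 (fun t : 'I_mu.+1 => phi (u + step * t%:R)).
Qed.

Lemma shift_max_eq (u : R) :
  exists2 t : nat, (t <= mu)%N & shift_max phi step mu u = phi (u + step * t%:R).
Proof.
have [[t te] _] := finmaxP ord0 (fun t : 'I_mu.+1 => phi (u + step * t%:R)).
by exists t => //; rewrite -ltnS.
Qed.

Context (phi_concave : concave_function phi) (step_gt0 : 0 < step).
Context (k_bounds : (0 < k <= mu)%N).
Context (phi_low : phi ((k%:R - 1) * step) = 0) (phi_high : phi (k%:R * step) = 0).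
Local Notation low := ((k%:R - 1) * step).
Local Notation high := (k%:R * step).
Local Notation Phi := (shift_max phi step mu).

Lemma highE : high = low + step. Proof. by ring. Qed.

Lemma low_lt_high : low < high. Proof. by rewrite highE ltrDl. Qed.

Lemma low_ge0 : 0 <= low.
Proof.
by apply: mulr_ge0 (ltW step_gt0); rewrite subr_ge0 ler1n; case/andP: k_bounds.
Qed.

Lemma exists_translate (u : R) :
  exists m : int, low <= u + m%:~R * step <= high.
Proof.
have st0 := step_gt0.
set q := Num.floor (u / step); exists (k%:Z - 1 - q).
have /andP[] := floor_itv (u / step).
rewrite -/q ler_pdivlMr // ltr_pdivrMr // !intrD !intrN => h1 h2.
rewrite -[k%:~R]/(k%:R); apply/andP; split; lra.
Qed.

(** The chord over [[low, high]] is horizontal, and [[x, y]] lies weakly to its right. *)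
Lemma phi_noninc (x y : R) : x < y -> low <= x -> high <= y -> phi y <= phi x.
Proof.
move=> xy lx hy.
have := concave_slope phi_concave low_lt_high xy lx hy.
rewrite phi_low phi_high subrr mul0r highE.
by rewrite addrAC subrr add0r pmulr_lle0 // subr_le0.
Qed.

Lemma phi_nondec (x y : R) : x < y -> x <= low -> y <= high -> phi x <= phi y.
Proof.
move=> xy lx hy.
have := concave_slope phi_concave xy low_lt_high lx hy.
rewrite phi_low phi_high subrr mul0r highE.
by rewrite [low + step]addrC addrK pmulr_lge0 // subr_ge0.
Qed.

Lemma phi_ge0 (x : R) : low <= x <= high -> 0 <= phi x.
Proof.
have st0 := step_gt0.
move=> /andP[lx xh].
move: lx xh; rewrite le_eqVlt => /predU1P[<-|lx]; first by rewrite phi_low.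
rewrite le_eqVlt => /predU1P[->|xh]; first by rewrite phi_high.
have := concave_slope phi_concave lx xh (ltW lx) (ltW xh).
rewrite phi_low phi_high.
rewrite sub0r subr0 mulNr -subr_ge0 opprK -mulrDr.
by rewrite pmulr_lge0 //; lra.
Qed.

(** A nonzero multiple of [step] carries [w] to [high] or beyond, or to [low] or below, where
    monotonicity applies. So within a class modulo [step], [phi] is largest at the representative in
    [[low, high]]. *)
Lemma phi_le_translate (w : R) (m : int) :
  low <= w <= high -> phi (w + m%:~R * step) <= phi w.
Proof.
have st0 := step_gt0.
move=> /andP[lw wh]; case: (ltrgtP m 0) => [m0|m0|->]; last by rewrite mul0r addr0.
- have mR : m%:~R <= -1 :> R by rewrite -[-1]/((-1)%:~R) ler_int -ltzD1.
  have : m%:~R * step <= - step by rewrite -mulN1r ler_pM2r.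
  by move=> ms; apply: phi_nondec => //; move: wh; rewrite highE; lra.
- have mR : 1 <= m%:~R :> R by rewrite -[1]/(1%:~R) ler_int.
  have ms : step <= m%:~R * step by rewrite ler_peMl // ltW.
  by apply: phi_noninc => //; rewrite ?highE; lra.
Qed.

Lemma shift_max_le_translate (u : R) (m : int) :
  low <= u + m%:~R * step <= high -> Phi u <= phi (u + m%:~R * step).
Proof.
move=> mu_itv; have [t _ ->] := shift_max_eq u.
have := phi_le_translate (t%:Z - m) mu_itv.
rewrite intrD intrN -[t%:~R]/(t%:R).
by have -> : u + m%:~R * step + (t%:R - m%:~R) * step = u + step * t%:R by ring.
Qed.

(** For these [u] some admissible [t] reaches [[low, high]]: the left end of the range is the point
    that [mu] steps carry to [low]. With [shift_max_le_translate], [Phi] is there the periodic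
    extension of [phi] from [[low, high]]. *)
Lemma shift_max_near_ge (u : R) (m : int) :
  - ((mu - k).+1%:R * step) <= u <= high -> phi (u + m%:~R * step) <= Phi u.
Proof.
have st0 := step_gt0.
case/andP: k_bounds => k0 kmu /andP[u_ge u_le].
have [p pu] := exists_translate u.
suff [t tmu tu] : exists2 t : nat, (t <= mu)%N & low <= u + step * t%:R <= high.
  apply: le_trans (shift_max_ge u tmu).
  have := phi_le_translate (m - t%:Z) tu.
  rewrite intrD intrN -[t%:~R]/(t%:R).
  by have -> : u + step * t%:R + (m%:~R - t%:R) * step = u + m%:~R * step by ring.
move: u_ge; rewrite -natr1 natrB // => u_ge.
(* A negative [p] forces [u = high], served by [t = 0]; below, [p > mu] forces [u] to be the left
   end, served by [t = mu]. *)
have [p0|p0] := leP 0 p; last first.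
  exists 0%N => //; rewrite mulr0 addr0 u_le andbT.
  have pR : p%:~R <= -1 :> R by rewrite -[-1]/((-1)%:~R) ler_int -ltzD1.
  have : p%:~R * step <= - step by rewrite -mulN1r ler_pM2r.
  by move: pu => /andP[]; rewrite highE; lra.
have [pmu|mup] := leP p mu%:Z.
  case: p p0 pu pmu => // p _ pu pmu; exists p => //.
  by rewrite [step * _]mulrC.
exists mu => //.
have pR : mu%:R + 1 <= p%:~R :> R.
  by rewrite -[mu%:R]/(mu%:Z%:~R) -[1]/(1%:~R) -intrD ler_int addrC lez1D.
have : (mu%:R + 1) * step <= p%:~R * step by rewrite ler_pM2r.
by case/andP: pu => *; apply/andP; split; lra.
Qed.

Lemma shift_max_near_ge0 (u : R) :
  - ((mu - k).+1%:R * step) <= u <= high -> 0 <= Phi u.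
Proof.
move=> uI; have [m mI] := exists_translate u.
exact: le_trans (phi_ge0 mI) (shift_max_near_ge m uI).
Qed.

(** One or more steps carry [u] to [high] or beyond, so [t = 0] is optimal. *)
Lemma shift_max_far (u : R) : low <= u -> Phi u = phi u.
Proof.
have st0 := step_gt0.
move=> lu; apply/eqP; rewrite eq_le; apply/andP; split; last first.
  by have := shift_max_ge u (leq0n mu); rewrite mulr0 addr0.
have [[|t] _ ->] := shift_max_eq u; first by rewrite mulr0 addr0.
have ts : step <= step * t.+1%:R by rewrite ler_peMr ?ler1n // ltW.
by apply: phi_noninc => //; rewrite ?highE; lra.
Qed.

(* On [low, high] a concave function vanishing at both ends is subadditive as
   a function on the circle of length [step] *)
Lemma phi_subadd_mod (w1 w2 : R) (m : int) :
  low <= w1 <= high -> low <= w2 <= high ->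
  phi (w1 + w2 + m%:~R * step) <= phi w1 + phi w2.
Proof.
have st0 := step_gt0.
move=> /andP[lw1 wh1] /andP[lw2 wh2].
(* One end of [[low, high]], where [phi] vanishes, is split off from [w1 + w2]; the remainder stays
   in the interval, and [w1], [w2] lie between that end and the remainder. *)
have [h|h] := leP (w1 + w2) (low + high).
  have wI : low <= w1 + w2 - low <= high by apply/andP; split; lra.
  have := phi_le_translate (k%:Z - 1 + m) wI.
  have -> : w1 + w2 - low + (k%:Z - 1 + m)%:~R * step = w1 + w2 + m%:~R * step.
    by rewrite !intrD intrN -[k%:Z%:~R]/(k%:R); ring.
  move=> /le_trans; apply.
  have := concave_majorize (x := low) (y1 := w1) (y2 := w2) phi_concave lw1.
  by move=> /(_ (w1 + w2 - low)); rewrite phi_low add0r; apply; lra.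
have wI : low <= w1 + w2 - high <= high by apply/andP; split; lra.
have := phi_le_translate (k%:Z + m) wI.
have -> : w1 + w2 - high + (k%:Z + m)%:~R * step = w1 + w2 + m%:~R * step.
  by rewrite intrD -[k%:Z%:~R]/(k%:R); ring.
move=> /le_trans; apply.
have := concave_majorize (x := w1 + w2 - high) (y1 := w1) (y2 := w2)
  (z := high) phi_concave.
by rewrite phi_high addr0; apply; lra.
Qed.

(** The upper bound by a translate holds everywhere, so only the summands, not the sum, must lie in
    the range of periodicity. *)
Lemma shift_max_near_subadd (u1 u2 : R) :
  - ((mu - k).+1%:R * step) <= u1 <= high ->
  - ((mu - k).+1%:R * step) <= u2 <= high ->
  Phi (u1 + u2) <= Phi u1 + Phi u2.
Proof.
move=> u1I u2I.
have [m1 m1I] := exists_translate u1; have [m2 m2I] := exists_translate u2.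
have [m mI] := exists_translate (u1 + u2).
apply: le_trans (shift_max_le_translate mI) _.
apply: le_trans (lerD (shift_max_near_ge m1 u1I) (shift_max_near_ge m2 u2I)).
apply: le_trans (phi_subadd_mod (m - m1 - m2) m1I m2I).
by rewrite !intrD !intrN le_eqVlt; apply/orP; left; apply/eqP; congr phi; ring.
Qed.

Lemma near_gap_le0 : - ((mu - k).+1%:R * step) <= 0 :> R.
Proof. by rewrite oppr_le0 mulr_ge0 // ltW. Qed.

(** Up to [high] periodicity suffices. If only the larger summand exceeds [high], the other has
    [Phi >= 0] and [phi] is nonincreasing; if both do, majorization against [high] and
    [u1 + u2 - high] applies. *)
Lemma shift_max_subadd_ge0 (u1 u2 : R) :
  0 <= u1 -> 0 <= u2 -> Phi (u1 + u2) <= Phi u1 + Phi u2.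
Proof.
have st0 := step_gt0.
wlog u12 : u1 u2 / u2 <= u1.
  move=> H u10 u20; have [/H|/ltW/H] := leP u2 u1; first exact.
  by rewrite addrC [Phi u1 + _]addrC; apply.
move=> u10 u20; have gap := near_gap_le0.
have [u1h|hu1] := leP u1 high.
  by apply: shift_max_near_subadd; apply/andP; split; lra.
have lh : low <= high by rewrite highE; lra.
have lowu1 : low <= u1 by lra.
have step0 := low_ge0.
rewrite (shift_max_far (u := u1 + u2)); last by lra.
rewrite (shift_max_far lowu1).
have [u2h|hu2] := leP u2 high.
  have : 0 <= Phi u2 by apply: shift_max_near_ge0; apply/andP; split; lra.
  suff : phi (u1 + u2) <= phi u1 by lra.
  move: u20; rewrite le_eqVlt => /predU1P[<-|u20]; first by rewrite addr0.
  by apply: phi_noninc; lra.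
rewrite (shift_max_far (u := u2)); last by lra.
have := concave_majorize (x := high) (y1 := u1) (y2 := u2) (z := u1 + u2 - high)
  phi_concave.
rewrite phi_high add0r => H; apply: le_trans (H _ _ _); try lra.
have high_gt0 : 0 < high by lra.
by apply: phi_noninc; lra.
Qed.

(** This is majorization for the outer pair [v1 + v2 - b], [b]. As [Phi] need not be concave, it is
    applied to [phi], at translates of the arguments by multiples of [step]. *)
Lemma shift_max_exchange (b v1 v2 : R) :
  high <= b -> 0 <= v1 <= b -> 0 <= v2 <= b ->
  Phi (v1 + v2 - b) + Phi b <= Phi v1 + Phi v2.
Proof.
have st0 := step_gt0.
wlog v12 : v1 v2 / v2 <= v1.
  move=> H hb v10 v20; have [/H|/ltW/H] := leP v2 v1; first exact.
  by rewrite (addrC v1) [Phi v1 + _]addrC; apply.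
move=> hb /andP[v10 v1b] /andP[v20 v2b]; have gap := near_gap_le0.
have lE := highE; have lb : low <= b by lra.
have hl := low_ge0.
have high_gt0 : 0 < high by lra.
rewrite (shift_max_far lb); set u := v1 + v2 - b.
have [hu|uh] := leP high u.
  rewrite !shift_max_far; try by rewrite /u in hu *; lra.
  by apply: concave_majorize => //; rewrite /u; lra.
(* [u + p * step] represents [u] in [[low, high]]; choosing it at least [u] later keeps [V2] from
   falling below [v2]. *)
have [p puI uleI] : exists2 p : int, low <= u + p%:~R * step <= high
    & u <= u + p%:~R * step.
  have [lu|ul] := leP low u.
    by exists 0; rewrite mul0r addr0 // lu ltW.
  by have [p /andP[lp ph]] := exists_translate u; exists p; [rewrite lp | lra].
have := shift_max_le_translate puI; set u' := u + p%:~R * step in puI uleI *.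
move=> Phiu; have {Phiu} : Phi u + phi b <= phi u' + phi b by rewrite lerD2r.
move=> /le_trans; apply; case/andP: (puI) => lu' u'h.
have [v1h|hv1] := leP v1 high; last first.
  set V2 := u' + b - v1.
  have H : phi u' + phi b <= phi v1 + phi V2.
    by apply: concave_majorize => //; rewrite /V2; lra.
  apply: le_trans H _; rewrite (shift_max_far (u := v1)) ?lerD2l; last by lra.
  have V2E : V2 = v2 + p%:~R * step by rewrite /V2 /u' /u; ring.
  have [v2h|hv2] := leP v2 high.
    by rewrite V2E; apply: shift_max_near_ge; apply/andP; split; lra.
  rewrite shift_max_far; last by lra.
  have : v2 <= V2 by rewrite /V2; rewrite /u in uleI; lra.
  rewrite le_eqVlt => /predU1P[<- //|v2V2].
  by apply: phi_noninc => //; lra.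
have v1I : - ((mu - k).+1%:R * step) <= v1 <= high by apply/andP; split; lra.
have v2I : - ((mu - k).+1%:R * step) <= v2 <= high by apply/andP; split; lra.
(* The translates [V1] and [V2] satisfy [V1 + V2 = u' + b]; if [V2] overshoots
   [b], it is moved back by one step, at no loss as [phi b <= phi (b - step)] *)
have [q /andP[qb bq]] : exists q : int, b - step < v1 + q%:~R * step <= b.
  exists (Num.floor ((b - v1) / step)).
  have /andP[] := floor_itv ((b - v1) / step).
  rewrite ler_pdivlMr // ltr_pdivrMr // intrD.
  by move=> *; apply/andP; split; lra.
set V1 := v1 + q%:~R * step in qb bq.
have V1le : phi V1 <= Phi v1 by exact: shift_max_near_ge.
set V2 := u' + b - V1.
have V2E : V2 = v2 + (p - q)%:~R * step.
  by rewrite /V2 /V1 /u' /u intrD intrN; ring.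
have [V2b|bV2] := leP V2 b.
  apply: (@le_trans _ _ (phi V1 + phi V2)).
    by apply: concave_majorize => //; rewrite /V2 in V2b *; lra.
  by apply: lerD => //; rewrite V2E; apply: shift_max_near_ge.
have W2le : phi (V2 - step) <= Phi v2.
  have -> : V2 - step = v2 + (p - q - 1)%:~R * step.
    by rewrite V2E !intrD !intrN; ring.
  exact: shift_max_near_ge.
apply: le_trans (lerD V1le W2le).
have bs : phi b <= phi (b - step) by apply: phi_noninc; lra.
have := concave_majorize (x := b - step) (y1 := V1) (y2 := V2 - step) (z := u')
  phi_concave.
by move=> /(_ ltac:(lra) ltac:(rewrite /V2 in bV2; lra) ltac:(rewrite /V2; lra)); lra.
Qed.

End ShiftMax.

Lemma concave_affine (R : realType) (f : R -> R) (p q c d : R) :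
  concave_function f -> concave_function (fun z => f (p + q * z) + (c + d * z)).
Proof.
move=> /concave_functionP fc; apply/concave_functionP => t x y t01.
have := fc t (p + q * x) (p + q * y) t01.
have -> : p + q * (t * x + (1 - t) * y) = t * (p + q * x) + (1 - t) * (p + q * y).
  by ring.
lra.
Qed.

Lemma shift_max_rev (R : realType) (phi : R -> R) (step : R) (mu : nat) (u : R) :
  shift_max (fun z => phi (mu%:R * step - z)) step mu u = shift_max phi step mu (- u).
Proof.
apply/eqP; rewrite eq_le; apply/andP; split.
  have [t tmu ->] := @shift_max_eq _ (fun z => phi (mu%:R * step - z)) step mu u.
  have := @shift_max_ge _ phi step mu (mu - t) (- u) (leq_subr _ _).
  by rewrite natrB //; congr (phi _ <= _); ring.
have [t tmu ->] := @shift_max_eq _ phi step mu (- u).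
have := @shift_max_ge _ (fun z => phi (mu%:R * step - z)) step mu (mu - t) u
  (leq_subr _ _).
by rewrite natrB //; congr (phi _ <= _); ring.
Qed.

(** The reflection [psi] vanishes at [(mu - k) * step] and one step further, so the case of
    nonnegative arguments applies with [(mu - k).+1] in place of [k]. *)
Lemma shift_max_subadd_le0 (R : realType) (phi : R -> R) (step : R) (k mu : nat)
    (u1 u2 : R) :
  concave_function phi -> 0 < step -> (0 < k <= mu)%N ->
  phi ((k%:R - 1) * step) = 0 -> phi (k%:R * step) = 0 -> u1 <= 0 -> u2 <= 0 ->
  shift_max phi step mu (u1 + u2) <=
  shift_max phi step mu u1 + shift_max phi step mu u2.
Proof.
move=> phic step0 /andP[k0 kmu] low0 high0 u10 u20.
pose psi z := phi (mu%:R * step - z).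
have psic : concave_function psi.
  have := concave_affine (mu%:R * step) (-1) 0 0 phic.
  congr concave_function; apply/boolp.funext => z.
  by rewrite /psi mulN1r mul0r !addr0.
have := @shift_max_subadd_ge0 _ psi step (mu - k).+1 mu psic step0 _ _ _ (- u1) (- u2).
rewrite !shift_max_rev opprD !opprK; apply; rewrite ?oppr_ge0 //.
- by rewrite /= ltn_subrL k0 (leq_trans k0 kmu).
- by rewrite /psi -natr1 natrB // -[RHS]high0; congr phi; ring.
- by rewrite /psi -natr1 natrB // -[RHS]low0; congr phi; ring.
Qed.

(** * Packings *)

Lemma subadditive_sum (R : realType) (I : finType) (S : {set I}) (h : R -> R)
    (b : I -> R) (x : I -> nat) :
  h 0 <= 0 -> (forall u v, 0 <= u -> 0 <= v -> h (u + v) <= h u + h v) ->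
  (forall i, i \in S -> 0 <= b i) ->
  h (\sum_(i in S) b i * (x i)%:R) <= \sum_(i in S) h (b i) * (x i)%:R.
Proof.
move=> h0 hD b0.
have hM u m : 0 <= u -> h (u * m%:R) <= h u * m%:R.
  move=> u0; elim: m => [|m IHm]; first by rewrite !mulr0.
  rewrite -natr1 !mulrDr !mulr1; apply: le_trans (hD _ _ _ u0) _.
    by rewrite mulr_ge0.
  by rewrite lerD2r.
(* Subadditivity is known only for nonnegative arguments, so the sign is carried along with the
   bound. *)
pose K u v := 0 <= u /\ h u <= v.
suff [] : K (\sum_(i in S) b i * (x i)%:R) (\sum_(i in S) h (b i) * (x i)%:R) by [].
apply: big_ind2 => [|u1 v1 u2 v2 [u10 hu1] [u20 hu2]|i /b0 bi0].
- by split.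
- by split; [exact: addr_ge0 | exact: le_trans (hD _ _ u10 u20) (lerD hu1 hu2)].
- by split; [rewrite mulr_ge0 | exact: hM].
Qed.

Lemma sum_split1 (R : realType) (I : finType) (S : {set I}) (b : I -> R)
    (x : I -> nat) (i : I) :
  i \in S ->
  \sum_(j in S) b j * (x j + (j == i))%:R = \sum_(j in S) b j * (x j)%:R + b i.
Proof.
move=> iS; under eq_bigr do rewrite natrD mulrDr.
rewrite big_split /= [X in _ + X](bigD1 i) //= eqxx mulr1.
rewrite [X in _ + (_ + X)]big1 ?addr0 // => j.
by case/andP => _ /negPf ->; rewrite mulr0.
Qed.

(* A packing of gap [d1 + d2] splits into packings of the gaps [d1] and [d2].
   An item fitting one of the gaps is put there and the gap shrinks. If no item
   fits, then two items fill both gaps, and a lone item is used either for one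
   gap or twice, once for each gap *)
Lemma packing_split (R : realType) (I : finType) (S : {set I}) (h : R -> R)
    (a : I -> R) (x : I -> nat) (d1 d2 : R) :
  (forall u v, 0 <= u -> 0 <= v -> h (u + v) <= h u + h v) ->
  (forall u v, u <= 0 -> v <= 0 -> h (u + v) <= h u + h v) ->
  (forall i u v, i \in S -> 0 <= u < a i -> 0 <= v < a i ->
     h (a i - u - v) + h (a i) <= h (a i - u) + h (a i - v) \/
     h (a i - u - v) <= h (a i - u) + h (- v)) ->
  (forall i, i \in S -> 0 <= a i) ->
  0 <= d1 -> 0 <= d2 ->
  let W d y := h (\sum_(i in S) a i * (y i)%:R - d)
               - \sum_(i in S) h (a i) * (y i)%:R in
  exists x1 x2 : I -> nat,
    [/\ forall i, (x1 i <= x i)%N, forall i, (x2 i <= x i)%N &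
        W (d1 + d2) x <= W d1 x1 + W d2 x2].
Proof.
move=> hpos hneg hone a0 + + W.
(* Adding an item [i] amounts to shrinking the gap by [a i] at the price [h (a i)]. *)
have W_split y i d : i \in S ->
    W d (fun j => y j + (j == i))%N = W (d - a i) y - h (a i).
  move=> iS; rewrite /W !sum_split1 //.
  by rewrite [X in h X - _](_ : _ = \sum_(j in S) a j * (y j)%:R - (d - a i)); ring.
have W_eq y z d : (forall i, i \in S -> y i = z i) -> W d y = W d z.
  by move=> yz; rewrite /W; congr (h (_ - _) - _); apply: eq_bigr => i /yz ->.
have W0 d : W d (fun=> 0%N) = h (- d).
  by rewrite /W !big1 ?sub0r ?subr0 // => i _; rewrite mulr0.
move: {2}(\sum_(i in S) x i)%N (leqnn (\sum_(i in S) x i)%N) => N.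
elim: N x d1 d2 => [|N IHN] x d1 d2 xN d10 d20.
  have x0 i : i \in S -> x i = 0%N.
    by move=> iS; move: xN; rewrite (bigD1 i) //=; lia.
  exists x, x; split=> //; rewrite !(W_eq x (fun=> 0%N)) // !W0 opprD.
  by apply: hneg; rewrite oppr_le0.
have [x0|] := boolP [forall i in S, x i == 0%N].
  by apply: IHN => //; rewrite big1 // => i iS; apply/eqP; apply: (forall_inP x0).
case/forall_inPn => i iS; rewrite -lt0n => xi.
have decr j : j \in S -> (0 < x j)%N ->
    exists y : I -> nat, [/\ forall l, x l = (y l + (l == j))%N &
      (\sum_(l in S) y l <= N)%N].
  move=> jS xj; exists (fun l => x l - (l == j))%N.
  have xE l : x l = ((x l - (l == j)) + (l == j))%N.
    by rewrite subnK //; case: eqP => // ->.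
  split=> //; move: xN; rewrite !(bigD1 j jS) /= eqxx subn1.
  rewrite [in X in _ -> X](eq_bigr x); first by lia.
  by move=> l /andP[_ /negPf ->]; rewrite subn0.
have fits j e1 e2 : j \in S -> (0 < x j)%N -> 0 <= e1 -> 0 <= e2 -> a j <= e1 ->
    exists x1 x2 : I -> nat, [/\ forall i, (x1 i <= x i)%N,
      forall i, (x2 i <= x i)%N & W (e1 + e2) x <= W e1 x1 + W e2 x2].
  move=> jS xj e10 e20 je1; have [y [xE yN]] := decr j jS xj.
  have [||y1 [y2 [y1y y2y Wy]]] := IHN y (e1 - a j) e2 yN; rewrite ?subr_ge0 //.
  exists (fun l => y1 l + (l == j))%N, y2; split.
  - by move=> l; rewrite xE leq_add2r.
  - by move=> l; rewrite xE (leq_trans (y2y l)) ?leq_addr.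
  - rewrite (W_eq x _ _ (fun l _ => xE l)) !W_split // (addrAC e1).
    by move: Wy; lra.
have fits2 j : j \in S -> (0 < x j)%N -> a j <= d2 ->
    exists x1 x2 : I -> nat, [/\ forall i, (x1 i <= x i)%N,
      forall i, (x2 i <= x i)%N & W (d1 + d2) x <= W d1 x1 + W d2 x2].
  move=> jS xj jd2; have [x2 [x1 [x2x x1x Wx]]] := fits j d2 d1 jS xj d20 d10 jd2.
  by exists x1, x2; split=> //; rewrite addrC [leRHS]addrC.
have [/(fits i d1 d2 iS xi d10 d20) //|d1i] := leP (a i) d1.
have [/(fits2 i iS xi) //|d2i] := leP (a i) d2.
have [y [xE yN]] := decr i iS xi.
have [y0|] := boolP [forall j in S, y j == 0%N].
  have Wx d : W d x = h (a i - d) - h (a i).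
    rewrite (W_eq x (fun l => 0 + (l == i))%N) ?W_split ?W0 ?opprB // => j jS.
    by rewrite xE; congr addn; apply/eqP; apply: (forall_inP y0).
  have := hone i d1 d2 iS; rewrite d10 d20 d1i d2i => /(_ isT isT)[H|H].
    by exists x, x; split=> //; rewrite !Wx opprD addrA; lra.
  by exists x, (fun=> 0%N); split=> //; rewrite !Wx W0 opprD addrA; lra.
case/forall_inPn => j jS; rewrite -lt0n => yj.
have xj : (0 < x j)%N by rewrite xE ltn_addr.
have [/(fits2 j jS xj) //|d2j] := leP (a j) d2.
(* Item [i] overfills the first gap and [j], which is part of [y], the second; both arguments of [h]
   are thus nonnegative and [hpos] applies. *)
exists (fun l => 0 + (l == i))%N, y; split.
- by move=> l; rewrite xE leq_addl.
- by move=> l; rewrite xE leq_addr.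
- rewrite (W_eq x _ _ (fun l _ => xE l)) !W_split // W0 opprB.
  have yd2 : 0 <= \sum_(l in S) a l * (y l)%:R - d2.
    rewrite subr_ge0 (le_trans (ltW d2j)) // (bigD1 j) //=.
    rewrite -[leLHS]addr0 lerD ?sumr_ge0 //.
      by rewrite ler_peMr ?a0 // ler1n.
    by move=> l /andP[lS _]; rewrite mulr_ge0 ?a0.
  have := hpos (a i - d1) _ _ yd2; rewrite subr_ge0 => /(_ (ltW d1i)).
  rewrite /W.
  by rewrite [X in h X <= _ -> _](_ : _ =
    \sum_(l in S) a l * (y l)%:R - (d1 + d2 - a i)); [lra | ring].
Qed.

(** * Dimension *)

Section AffineIndependence.
Context {R : realType} {n : nat}.
Local Notation V := (R^o * 'rV[R]_n)%type.

Lemma affine_comb_coord m (c : 'I_m -> R) (p : 'I_m -> V) (i : 'I_n) :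
  (\sum_j c j *: p j).2 0 i = \sum_j c j * (p j).2 0 i.
Proof.
rewrite (big_morph (fun v : V => v.2 0 i) (id1 := 0) (op1 := +%R)) //.
- by apply: eq_bigr => j _; rewrite /= mxE.
- by move=> u v /=; rewrite mxE.
- by rewrite /= mxE.
Qed.

Lemma affine_comb_fst m (c : 'I_m -> R) (p : 'I_m -> V) :
  (\sum_j c j *: p j).1 = \sum_j c j * (p j).1.
Proof. exact: (big_morph (fun v : V => v.1) (id1 := 0) (op1 := +%R)). Qed.

(** The rows [(1, w, x)] of [M] are linearly independent, and there are [n + 2] columns. *)
Lemma affinely_independent_le m (p : 'I_m -> V) :
  affinely_independent p -> (m <= n.+2)%N.
Proof.
move=> ind.
pose M : 'M[R]_(m, 1 + (1 + n)) :=
  row_mx (const_mx 1) (row_mx (\col_j (p j).1) (\matrix_j (p j).2)).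
have /eqP <- : row_free M; last exact: rank_leq_col.
apply: inj_row_free => v; rewrite !mul_mx_row => vM.
have := congr1 lsubmx vM; rewrite row_mxKl linear0 => sum0.
move: vM => /(congr1 rsubmx); rewrite row_mxKr linear0 => vM.
have := congr1 lsubmx vM; rewrite row_mxKl linear0 => fst0.
have := congr1 rsubmx vM; rewrite row_mxKr linear0 => snd0.
apply/rowP => j; rewrite mxE; apply: (ind (fun j => v 0 j)).
- move/matrixP/(_ 0 0): sum0; rewrite !mxE => vM0.
  by rewrite -[RHS]vM0; apply: eq_bigr => l _; rewrite mxE mulr1.
- apply/eqP; rewrite -pair_eqE /=; apply/andP; split; apply/eqP.
    rewrite affine_comb_fst; move/matrixP/(_ 0 0): fst0; rewrite !mxE => vM0.
    by rewrite -[RHS]vM0; apply: eq_bigr => l _; rewrite mxE.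
  apply/rowP => i; rewrite affine_comb_coord.
  move/matrixP/(_ 0 i): snd0; rewrite !mxE => vM0.
  by rewrite -[RHS]vM0; apply: eq_bigr => l _; rewrite mxE.
Qed.

Context (b0 : R) (b : 'I_n -> R).
Local Notation L v := (b0 + \sum_i b i * (v : V).2 0 i).

Lemma affine_comb_graph m (c : 'I_m -> R) (p : 'I_m -> V) :
  \sum_j c j = 0 -> \sum_j c j *: p j = 0 ->
  \sum_j c j * (L (p j) - (p j).1) = 0.
Proof.
move=> c0 cp0.
under eq_bigr do rewrite mulrBr mulrDr mulr_sumr.
rewrite sumrB big_split /= -mulr_suml c0 mul0r add0r -affine_comb_fst cp0 subr0.
rewrite exchange_big big1 //= => i _.
under eq_bigr do rewrite mulrCA.
by rewrite -mulr_sumr -affine_comb_coord cp0 mxE mulr0.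
Qed.

(** On the graph of [L] the first coordinate is determined by the others, so its column drops out of
    the rank count. *)
Lemma affinely_independent_graph_le m (p : 'I_m -> V) :
  (forall j, (p j).1 = L (p j)) -> affinely_independent p -> (m <= n.+1)%N.
Proof.
move=> pL ind.
pose M : 'M[R]_(m, 1 + n) := row_mx (const_mx 1) (\matrix_j (p j).2).
have /eqP <- : row_free M; last exact: rank_leq_col.
apply: inj_row_free => v; rewrite mul_mx_row => vM.
have := congr1 lsubmx vM; rewrite row_mxKl linear0 => sum0.
have := congr1 rsubmx vM; rewrite row_mxKr linear0 => snd0.
have {}sum0 : \sum_j v 0 j = 0.
  move/matrixP/(_ 0 0): sum0; rewrite !mxE => vM0.
  by rewrite -[RHS]vM0; apply: eq_bigr => l _; rewrite mxE mulr1.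
have {}snd0 i : \sum_j v 0 j * (p j).2 0 i = 0.
  move/matrixP/(_ 0 i): snd0; rewrite !mxE => vM0.
  by rewrite -[RHS]vM0; apply: eq_bigr => l _; rewrite mxE.
apply/rowP => j; rewrite mxE; apply: (ind (fun j => v 0 j)) => //.
apply/eqP; rewrite -pair_eqE /=; apply/andP; split; apply/eqP.
  rewrite affine_comb_fst; under eq_bigr do rewrite pL mulrDr mulr_sumr.
  rewrite big_split /= -mulr_suml sum0 mul0r add0r exchange_big big1 //= => i _.
  under eq_bigr do rewrite mulrCA.
  by rewrite -mulr_sumr snd0 mulr0.
by apply/rowP => i; rewrite affine_comb_coord snd0 mxE.
Qed.

(** [L v - v.1] vanishes at every [p j] but not at [q], so a dependence has weight zero on [q]. The
    family lists [q] at index [0], then [p]. *)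
Lemma affinely_independent_cons m (p : 'I_m -> V) (q : V) :
  (forall j, (p j).1 = L (p j)) -> q.1 != L q -> affinely_independent p ->
  affinely_independent (fun j => oapp p q (unlift (ord0 : 'I_m.+1) j)).
Proof.
move=> pL qL ind c c0 cp0.
have := affine_comb_graph c0 cp0.
rewrite big_ord_recl unlift_none /= [X in _ + X = _]big1 => [|i _].
  rewrite addr0 => /eqP.
  rewrite mulf_eq0 subr_eq0 [_ == q.1]eq_sym (negPf qL) orbF => /eqP cq.
  have lift_ind i : c (lift ord0 i) = 0.
    apply: (ind (fun i => c (lift ord0 i))).
      by rewrite -[RHS]c0 big_ord_recl cq add0r.
    rewrite -[RHS]cp0 big_ord_recl cq scale0r add0r.
    by apply: eq_bigr => l _; rewrite liftK.
  by move=> j; case: (unliftP ord0 j) => [i|] ->.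
by rewrite liftK /= -pL subrr mulr0.
Qed.

(** Together with [q], the tight points [p] give the hull dimension [n + 1]; alone they give the
    face dimension [n], the most that the graph of [L] allows. Validity passes to the hull because
    the half-space is convex. *)
Lemma facet_defining_convex_hull (A : set V) (p : 'I_n.+1 -> V) (q : V) :
  (forall v, A v -> v.1 <= L v) ->
  (forall j, A (p j)) -> (forall j, (p j).1 = L (p j)) ->
  affinely_independent p -> A q -> q.1 != L q ->
  facet_defining (convex_hull A) (fun v => v.1) (fun v => L v).
Proof.
move=> AL Ap pL ind Aq qL.
have hullA v : A v -> convex_hull A v by move=> Av C [_]; apply.
split=> [v Av|].
  suff cvx : convex_set [set v : V | v.1 <= L v]%classic by apply: (Av _ (conj cvx AL)).
  move=> x y t /set_mem xL /set_mem yL; apply: mem_set => /=.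
  have : t%:num * x.1 + (1 - t%:num) * y.1 <= t%:num * L x + (1 - t%:num) * L y.
    have t1 : t%:num <= 1 by apply: le1.
    by apply: lerD; apply: ler_wpM2l => //; rewrite subr_ge0.
  move=> /le_trans; apply.
  rewrite !mulrDr addrACA -mulrDl [_ + (1 - _)]addrC subrK mul1r lerD2l.
  rewrite !mulr_sumr -big_split /= le_eqVlt; apply/orP; left; apply/eqP.
  by apply: eq_bigr => i _; rewrite !mxE /unstable.onem; ring.
exists n.+1%:Z; split; split.
- exists n.+2, (fun j => oapp p q (unlift (ord0 : 'I_n.+2) j)); split.
  + by move=> j; case: (unlift _ j) => [i|]; apply: hullA => //=.
  + exact: affinely_independent_cons.
  + by rewrite -[n.+2]addn1 PoszD addrK.
- by move=> m r _ /affinely_independent_le; lia.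
- exists n.+1, p; split => // j; split; [exact: hullA | exact: pL].
- move=> m r rL /affinely_independent_graph_le - /(_ (fun j => (rL j).2)); lia.
Qed.

End AffineIndependence.

(** * The lifted inequality *)

Lemma finmaxDr (R : realType) (I : finType) (i0 : I) (F : I -> R) (c : R) :
  finmax i0 (fun i => F i + c) = finmax i0 F + c.
Proof.
have [[i iE] i_max] := finmaxP i0 (fun i => F i + c).
have [[j jE] j_max] := finmaxP i0 F.
apply/eqP; rewrite eq_le; apply/andP; split; first by rewrite iE lerD2r.
by rewrite jE i_max.
Qed.

Section Lifting.
Context {R : realType} {n : nat} {g : R -> R} {a : 'rV[R]_n} {mu : 'I_n -> nat}.
Context {s : 'I_n} {S0 : {set 'I_n}} {k : nat}.
Local Notation step := (a 0 s).
Local Notation r := (rho g a s k / step).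
Local Notation zt := (zeta g a mu s k).
Local Notation et := (eta g a mu s S0 k).

(** The [phi] of the outline: the chord is written through its right end, with slope [r]. *)
Definition tilt (z : R) : R := g z - g (k%:R * step) - r * (z - k%:R * step).
Local Notation Phi := (shift_max tilt step (mu s)).

Lemma zeta_eq (delta : R) :
  exists2 t : nat, (t <= mu s)%N &
  zt delta = g (delta + step * t%:R) - rho g a s k * (t%:R - k%:R) - g (k%:R * step).
Proof.
have [t ->] : exists t, zt delta = _ t := proj1 (finmaxP _ _).
by exists t => //; rewrite -ltnS.
Qed.

Lemma eta_ge (delta : R) (x : 'I_n -> nat) :
  (forall i, (x i <= mu i)%N) ->
  g (delta + \sum_(i in s |: S0) a 0 i * (x i)%:R)
  - \sum_(i in S0) zt (a 0 i) * (x i)%:R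
  + (k%:R - (x s)%:R) * rho g a s k - g (k%:R * step) <= et delta.
Proof.
move=> xmu; pose X : {dffun forall i, 'I_(mu i).+1} := [ffun i => inord (x i)].
have XE i : X i = x i :> nat by rewrite ffunE inordK ?ltnS.
apply: le_trans (proj2 (finmaxP _ _) X); rewrite XE.
under [in X in _ <= X]eq_bigr do rewrite XE.
by under [in X in _ <= _ - X + _ - _]eq_bigr do rewrite XE.
Qed.

Lemma eta_eq (delta : R) :
  exists2 x : 'I_n -> nat, (forall i, (x i <= mu i)%N) &
  et delta = g (delta + \sum_(i in s |: S0) a 0 i * (x i)%:R)
  - \sum_(i in S0) zt (a 0 i) * (x i)%:R
  + (k%:R - (x s)%:R) * rho g a s k - g (k%:R * step).
Proof.
have [x ->] : exists x, et delta = _ x := proj1 (finmaxP _ _).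
by exists (fun i => x i : nat) => // i; rewrite -ltnS.
Qed.

Context (g_concave : concave_function g) (a_ge0 : forall i, 0 <= a 0 i).
Context (step_gt0 : 0 < step) (sS0 : s \notin S0) (k_bounds : (0 < k <= mu s)%N).

Lemma tilt_concave : concave_function tilt.
Proof.
have := concave_affine 0 1 (r * (k%:R * step) - g (k%:R * step)) (- r) g_concave.
congr concave_function; apply/boolp.funext => z.
by rewrite /tilt mul1r add0r; ring.
Qed.

Lemma tilt_high : tilt (k%:R * step) = 0.
Proof. by rewrite /tilt !subrr mulr0 subr0. Qed.

Lemma tilt_low : tilt ((k%:R - 1) * step) = 0.
Proof. by rewrite /tilt /rho; field; rewrite gt_eqF. Qed.

Lemma zetaE (delta : R) : zt delta = Phi delta + r * delta.
Proof.
rewrite /zeta /shift_max -finmaxDr; congr finmax; apply/boolp.funext => x.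
by rewrite /tilt; field; rewrite gt_eqF.
Qed.

(** The linear terms in [x] from [tilt], [zeta] and [rho] cancel, leaving only [r * delta]. *)
Lemma eta_objectiveE (delta : R) (x : 'I_n -> nat) :
  g (delta + \sum_(i in s |: S0) a 0 i * (x i)%:R)
  - \sum_(i in S0) zt (a 0 i) * (x i)%:R
  + (k%:R - (x s)%:R) * rho g a s k - g (k%:R * step) =
  tilt (\sum_(i in S0) a 0 i * (x i)%:R + delta + step * (x s)%:R)
  - \sum_(i in S0) Phi (a 0 i) * (x i)%:R + r * delta.
Proof.
rewrite big_setU1 //=.
have -> : \sum_(i in S0) zt (a 0 i) * (x i)%:R =
    \sum_(i in S0) Phi (a 0 i) * (x i)%:R + r * \sum_(i in S0) a 0 i * (x i)%:R.
  rewrite mulr_sumr -big_split; apply: eq_bigr => i _ /=.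
  by rewrite zetaE mulrDl -mulrA.
rewrite /tilt.
set A := \sum_(i in S0) a 0 i * _.
have -> : delta + (step * (x s)%:R + A) = A + delta + step * (x s)%:R by ring.
by field; rewrite gt_eqF.
Qed.

(** The maximum over [x s] is the one inside [Phi]: the optimal [t] overwrites [x s], which the sums
    over [S0] do not see. *)
Lemma packing_le_eta (delta : R) (x : 'I_n -> nat) :
  (forall i, (x i <= mu i)%N) ->
  Phi (\sum_(i in S0) a 0 i * (x i)%:R + delta)
  - \sum_(i in S0) Phi (a 0 i) * (x i)%:R + r * delta <= et delta.
Proof.
move=> xmu; have [t tmu ->] := @shift_max_eq _ tilt step (mu s)
  (\sum_(i in S0) a 0 i * (x i)%:R + delta).
pose y i := if i == s then t else x i.
have ymu i : (y i <= mu i)%N by rewrite /y; case: eqP => // ->.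
have sumE b : \sum_(i in S0) b i * (y i)%:R = \sum_(i in S0) b i * (x i)%:R :> R.
  by apply: eq_bigr => i; rewrite /y; case: eqP => // -> /(negP sS0).
by have := eta_ge delta ymu; rewrite eta_objectiveE !sumE /y eqxx.
Qed.

Lemma eta_le_packing (delta : R) :
  exists2 x : 'I_n -> nat, (forall i, (x i <= mu i)%N) &
  et delta <= Phi (\sum_(i in S0) a 0 i * (x i)%:R + delta)
  - \sum_(i in S0) Phi (a 0 i) * (x i)%:R + r * delta.
Proof.
have [x xmu ->] := eta_eq delta; exists x => //.
by rewrite eta_objectiveE !lerD2r shift_max_ge.
Qed.

Let Phi_subadd :=
  shift_max_subadd_ge0 tilt_concave step_gt0 k_bounds tilt_low tilt_high.

(** At [delta = 0] a packing is worth at most zero by subadditivity of [Phi]. That [Phi 0 <= 0]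
    holds because [k] steps carry [0] to a zero of [tilt]. *)
Lemma eta0_le0 : et 0 <= 0.
Proof.
have [x _] := eta_le_packing 0; rewrite mulr0 !addr0 => /le_trans; apply.
rewrite subr_le0; apply: subadditive_sum => //.
have := @shift_max_le_translate _ _ _ _ (mu s)
  tilt_concave step_gt0 tilt_low tilt_high 0 k%:Z.
rewrite add0r -[k%:~R]/(k%:R) tilt_high; apply.
by rewrite lexx andbT ler_pM2r // gerBl.
Qed.

Context (large_or_first : large_part a s S0 k = S0 \/ k = 1%N).

(** A large item allows the exchange inequality with [b = a_i]. Otherwise [k = 1] and [a_i] is below
    one step, so [a_i - u] and [- v] both lie in the range of periodicity. *)
Lemma single_item_split (i : 'I_n) (u v : R) :
  i \in S0 -> 0 <= u < a 0 i -> 0 <= v < a 0 i ->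
  Phi (a 0 i - u - v) + Phi (a 0 i) <= Phi (a 0 i - u) + Phi (a 0 i - v) \/
  Phi (a 0 i - u - v) <= Phi (a 0 i - u) + Phi (- v).
Proof.
move=> iS0 /andP[u0 ua] /andP[v0 va]; have [ha|ah] := leP (k%:R * step) (a 0 i).
  left; rewrite (_ : a 0 i - u - v = a 0 i - u + (a 0 i - v) - a 0 i); last by ring.
  apply: (shift_max_exchange (k := k)) => //; try exact: tilt_concave.
  - exact: tilt_low.
  - exact: tilt_high.
  - by apply/andP; split; lra.
  - by apply/andP; split; lra.
right; have k1 : k = 1%N.
  by case: large_or_first => // /setP/(_ i); rewrite inE iS0 leNgt ah.
apply: (shift_max_near_subadd (k := k)) => //.
- exact: tilt_concave.
- exact: tilt_low.
- exact: tilt_high.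
- have := near_gap_le0 (k := k) (mu := mu s) step_gt0.
  by move=> gap; apply/andP; split; lra.
have st0 := step_gt0.
have : step <= (mu s - k).+1%:R * step by rewrite ler_peMl ?ler1n // ltW.
by move: ah; rewrite k1 mul1r => *; apply/andP; split; lra.
Qed.

(** An optimal packing splits into two packings within the same box, and the term [r * delta] is
    additive. *)
Lemma eta_subadd (d1 d2 : R) :
  0 <= d1 -> 0 <= d2 -> et (- (d1 + d2)) <= et (- d1) + et (- d2).
Proof.
move=> d10 d20; have [x xmu etx] := eta_le_packing (- (d1 + d2)).
have Phi_subadd_le0 u v : u <= 0 -> v <= 0 -> Phi (u + v) <= Phi u + Phi v.
  by apply: shift_max_subadd_le0 tilt_concave step_gt0 k_bounds tilt_low tilt_high.
have [x1 [x2 [x1x x2x]]] := packing_split x Phi_subadd Phi_subadd_le0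
  single_item_split (fun i _ => a_ge0 i) d10 d20.
have x1mu i : (x1 i <= mu i)%N by apply: leq_trans (x1x i) _.
have x2mu i : (x2 i <= mu i)%N by apply: leq_trans (x2x i) _.
have := packing_le_eta (- d1) x1mu; have := packing_le_eta (- d2) x2mu.
by move: etx; lra.
Qed.

(** [y] stands for [mu - x] on [S1]. The left side is bounded through [eta] at [- sum a_i y_i],
    which subadditivity distributes over the items. *)
Lemma lifted_inequality (S1 : {set 'I_n}) (x y : 'I_n -> nat) :
  (forall i, (x i <= mu i)%N) ->
  g (\sum_(i in s |: S0) a 0 i * (x i)%:R - \sum_(i in S1) a 0 i * (y i)%:R) <=
  \sum_(i in S0) zt (a 0 i) * (x i)%:R
  + \sum_(i in S1) et (- a 0 i) * (y i)%:R
  + rho g a s k * ((x s)%:R - k%:R) + g (k%:R * step).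
Proof.
move=> xmu; rewrite [X in g X]addrC.
have := eta_ge (- \sum_(i in S1) a 0 i * (y i)%:R) xmu.
have := subadditive_sum (S := S1) (h := fun d => et (- d)) (b := a 0) y _ eta_subadd.
rewrite oppr0 => /(_ eta0_le0 (fun i _ => a_ge0 i)).
by lra.
Qed.

End Lifting.

(** * The points of equality and the facet *)

(** Coordinates are used in the order [S1], [S0], [s]. For [i] in [S1] only [X i] departs from
    [mu i], so its weight vanishes; the remaining block on [S0] is an identity matrix; finally
    [k - 1] and [k] at [s] separate [X0] from [X s]. *)
Lemma triangular_affinely_independent (R : realType) (n : nat) (s : 'I_n)
    (S0 S1 : {set 'I_n}) (k : nat) (mu X0 : 'I_n -> nat) (X : 'I_n -> 'I_n -> nat)
    (w : 'I_n.+1 -> R) :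
  s \notin S0 -> s \notin S1 -> s |: (S0 :|: S1) = [set: 'I_n]%SET -> (0 < k)%N ->
  X0 s = k.-1 -> (forall j, j \in S0 -> X0 j = 0%N) ->
  (forall j, j \in S1 -> X0 j = mu j) ->
  X s s = k -> (forall j, j \in S0 -> X s j = 0%N) ->
  (forall i j, j \in S1 -> i != j -> X i j = mu j) ->
  (forall j, j \in S1 -> ((X j j).+1 = mu j)%N) ->
  (forall i j, i \in S0 -> j \in S0 -> X i j = (i == j)) ->
  affinely_independent (fun j => (w j, \row_i
     (oapp X X0 (unlift ord0 j) i)%:R) : R^o * 'rV[R]_n).
Proof.
move=> sS0 sS1 cover k0 X0s X0S0 X0S1 Xss XsS0 XS1 XS1' XS0 c c0 cp0.
have coord i : c ord0 * (X0 i)%:R + \sum_j c (lift ord0 j) * (X j i)%:R = 0.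
  have := affine_comb_coord c (fun j => (w j, \row_i
     (oapp X X0 (unlift ord0 j) i)%:R) : R^o * 'rV[R]_n) i.
  rewrite cp0 big_ord_recl /= unlift_none !mxE /= => e; rewrite [RHS]e; congr (_ + _).
  by apply: eq_bigr => j _; rewrite liftK mxE.
move: c0; rewrite big_ord_recl => c0.
have cS1 i : i \in S1 -> c (lift ord0 i) = 0.
  move=> iS1.
  have XE j : (X j i)%:R = (mu i)%:R - (j == i)%:R :> R.
    have [->|ji] := eqVneq j i; first by rewrite -XS1' // -natr1 addrK.
    by rewrite XS1 // subr0.
  have := coord i; rewrite X0S1 //; under eq_bigr do rewrite XE mulrBr.
  rewrite sumrB -mulr_suml addrA -mulrDl c0 mul0r sub0r (bigD1 i) //= eqxx mulr1.
  rewrite big1 => [|j /negPf ->]; last by rewrite mulr0.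
  by rewrite addr0 => /eqP; rewrite oppr_eq0 => /eqP.
have cS0 i : i \in S0 -> c (lift ord0 i) = 0.
  move=> iS0; have := coord i; rewrite X0S0 // mulr0 add0r (bigD1 i) //= XS0 // eqxx.
  rewrite mulr1 big1 ?addr0 // => j ji.
  have : j \in s |: (S0 :|: S1) by rewrite cover inE.
  rewrite !inE => /or3P[/eqP->|jS0|/cS1->].
  - by rewrite XsS0 // mulr0.
  - by rewrite XS0 // (negPf ji) mulr0.
  - by rewrite mul0r.
have c_off j : j != s -> c (lift ord0 j) = 0.
  move=> js; have : j \in s |: (S0 :|: S1) by rewrite cover inE.
  by rewrite !inE (negPf js) /= => /orP[/cS0|/cS1].
have := coord s; rewrite (bigD1 s) //= big1 => [|j /c_off ->]; last by rewrite mul0r.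
move: c0; rewrite (bigD1 s) //= big1 => [|j /c_off //].
rewrite !addr0 X0s Xss -{2}(prednK k0) -natr1 => c0 cs.
have cs0 : c (lift ord0 s) = 0.
  have : (c ord0 + c (lift ord0 s)) * (k.-1)%:R = 0 by rewrite c0 mul0r.
  by move: cs; lra.
move=> j; case: (unliftP ord0 j) => [i|] ->; last by move: c0; rewrite cs0 addr0.
by have [->|/c_off] := eqVneq i s.
Qed.

Theorem theorem4p13 (R : realType) (n : nat) (f : R -> R)
    (a : 'rV[R]_n) (mu : 'I_n -> nat) (s : 'I_n) (S0 S1 : {set 'I_n}) (k : nat) :
  (1 <= n)%N ->
  concave_function f ->
  (forall i, 0 <= a 0 i) ->
  (forall i, (1 <= mu i)%N) ->
  0 < a 0 s ->
  s \notin S0 -> s \notin S1 -> [disjoint S0 & S1] ->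
  s |: (S0 :|: S1) = [set: 'I_n]%SET ->
  (1 <= k <= mu s)%N ->
  large_part a s S0 k = S0 \/ k = 1%N ->
  let g := shift_by f a mu S1 in
  facet_defining (convex_hull (mixed_set f a mu))
    (fun p => p.1)
    (fun p => \sum_(i in S0) zeta g a mu s k (a 0 i) * p.2 0 i
              + \sum_(i in S1) eta g a mu s S0 k (- a 0 i) * ((mu i)%:R - p.2 0 i)
              + rho g a s k * (p.2 0 s - k%:R)
              + g (k%:R * a 0 s)).
Proof.
move=> _ fc a_ge0 mu_gt0 as0 sS0 sS1 dis cover kb large g.
have /andP[k0 kmu] := kb.
have gc : concave_function g.
  have := concave_affine (\sum_(i in S1) (mu i)%:R * a 0 i) 1 0 0 fc.
  congr concave_function; apply/boolp.funext => z.
  by rewrite /g /shift_by mul1r mul0r !addr0 addrC.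
have notS1 i : (i \notin S1) = (i \in s |: S0).
  have : i \in s |: (S0 :|: S1) by rewrite cover inE.
  rewrite !inE.
  have [->|_ /=] := eqVneq i s; first by rewrite sS1.
  by have := disjointFr dis (x := i); case: (i \in S0) => [->|/= _ ->].
have sum_split (F : 'I_n -> R) :
    \sum_i F i = F s + \sum_(i in S0) F i + \sum_(i in S1) F i.
  rewrite (bigID (mem S1)) /= addrC (eq_bigl (mem (s |: S0))) => [|i].
    by rewrite big_setU1.
  exact: notS1.
pose zt i := zeta g a mu s k (a 0 i); pose et i := eta g a mu s S0 k (- a 0 i).
pose rhs (x y : 'I_n -> nat) : R := \sum_(i in S0) zt i * (x i)%:R
  + \sum_(i in S1) et i * (y i)%:R + rho g a s k * ((x s)%:R - k%:R)
  + g (k%:R * a 0 s).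
pose lhs (x y : 'I_n -> nat) : R :=
  g (\sum_(i in s |: S0) a 0 i * (x i)%:R - \sum_(i in S1) a 0 i * (y i)%:R).
have lhs_le x y : (forall i, (x i <= mu i)%N) -> lhs x y <= rhs x y.
  exact: lifted_inequality.
(* Undoing the complementation on [S1] turns [et i] into [- et i] and moves [et i * mu i] to the
   constant. *)
pose b0 := g (k%:R * a 0 s) - rho g a s k * k%:R + \sum_(i in S1) et i * (mu i)%:R.
pose b i := if i \in S0 then zt i else if i \in S1 then - et i else rho g a s k.
have rhsE (x : 'rV[R]_n) : \sum_(i in S0) zt i * x 0 i
    + \sum_(i in S1) et i * ((mu i)%:R - x 0 i)
    + rho g a s k * (x 0 s - k%:R) + g (k%:R * a 0 s) = b0 + \sum_i b i * x 0 i.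
  rewrite sum_split {1}/b (negPf sS0) (negPf sS1).
  rewrite (eq_bigr (fun i => b i * x 0 i)) => [|i iS0]; last by rewrite /b iS0.
  have -> : \sum_(i in S1) et i * ((mu i)%:R - x 0 i) =
      \sum_(i in S1) et i * (mu i)%:R + \sum_(i in S1) b i * x 0 i.
    rewrite -big_split; apply: eq_bigr => i iS1 /=.
    by rewrite /b (disjointFl dis iS1) iS1; ring.
  by rewrite /b0; ring.
have -> : (fun p : R^o * 'rV[R]_n =>
    \sum_(i in S0) zeta g a mu s k (a 0 i) * p.2 0 i
    + \sum_(i in S1) eta g a mu s S0 k (- a 0 i) * ((mu i)%:R - p.2 0 i)
    + rho g a s k * (p.2 0 s - k%:R) + g (k%:R * a 0 s)) =
    (fun p => b0 + \sum_i b i * p.2 0 i).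
  by apply/boolp.funext => p; exact: rhsE.
(* [y] holds the complemented variables on [S1]; the truncated subtraction is exact when [y <= mu]
   there. *)
pose cpl (x y : 'I_n -> nat) i := if i \in S1 then (mu i - y i)%N else x i.
have f_cpl x y : (forall i, i \in S1 -> (y i <= mu i)%N) ->
    f (\sum_i a 0 i * (cpl x y i)%:R) = lhs x y.
  move=> ymu; rewrite /lhs /g /shift_by; congr f.
  rewrite sum_split big_setU1 //= {1}/cpl (negPf sS1).
  rewrite (eq_bigr (fun i => a 0 i * (x i)%:R)) => [|i iS0]; last first.
    by rewrite /cpl (disjointFr dis iS0).
  rewrite -!addrA; congr (_ + (_ + _)); rewrite addrC -sumrB.
  by apply: eq_bigr => i iS1; rewrite /cpl iS1 natrB ?ymu //; ring.
have L_cpl x y : (forall i, i \in S1 -> (y i <= mu i)%N) ->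
    b0 + \sum_i b i * (\row_i (cpl x y i)%:R : 'rV[R]_n) 0 i = rhs x y.
  move=> ymu; rewrite -rhsE /rhs; congr (_ + _ + _ * (_ - _) + _).
  - by apply: eq_bigr => i iS0; rewrite mxE /cpl (disjointFr dis iS0).
  - by apply: eq_bigr => i iS1; rewrite mxE /cpl iS1 natrB ?ymu //; ring.
  - by rewrite mxE /cpl (negPf sS1).
have cpl_mu x y i : (forall i, (x i <= mu i)%N) -> (cpl x y i <= mu i)%N.
  by move=> xmu; rewrite /cpl; case: ifP => // _; exact: leq_subr.
have mixed x y w : (forall i, (x i <= mu i)%N) ->
    (forall i, i \in S1 -> (y i <= mu i)%N) ->
    w <= lhs x y ->
    mixed_set f a mu (w, \row_i (cpl x y i)%:R).
  move=> xmu ymu wl; split=> /= [|i].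
    rewrite (eq_bigr (fun i => a 0 i * (cpl x y i)%:R)) ?f_cpl // => i _.
    by rewrite mxE.
  by rewrite mxE; split; [exact: natr_int | rewrite ler0n ler_nat cpl_mu].
pose e (i j : 'I_n) : nat := i == j.
have e_mu i j : (e i j <= mu j)%N by rewrite (leq_trans (leq_b1 _)).
have sum_e (S : {set 'I_n}) (F : 'I_n -> R) i :
    \sum_(j in S) F j * (e i j)%:R = if i \in S then F i else 0.
  case: ifP => iS.
    rewrite (bigD1 i) //= /e eqxx mulr1 big1 ?addr0 // => j /andP[_ ji].
    by rewrite eq_sym (negPf ji) mulr0.
  rewrite big1 // => j jS; rewrite /e; case: eqP => [ij|_]; last by rewrite mulr0.
  by rewrite -ij iS in jS.
pose x_ t i j : nat := if j == s then t else e i j.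
have x_mu t i : (t <= mu s)%N -> forall j, (x_ t i j <= mu j)%N.
  by move=> tmu j; rewrite /x_; case: eqP => [->|].
have x_S0 t i j : j \in S0 -> x_ t i j = e i j.
  by move=> jS0; rewrite /x_; case: eqP => // js; rewrite -js jS0 in sS0.
have sum_x (F : 'I_n -> R) t i :
    \sum_(j in S0) F j * (x_ t i j)%:R = if i \in S0 then F i else 0.
  by rewrite -sum_e; apply: eq_bigr => j /x_S0 ->.
have x_s t i : x_ t i s = t by rewrite /x_ eqxx.
have tight_s t : t = k \/ t = k.-1 -> lhs (x_ t s) (e s) = rhs (x_ t s) (e s).
  rewrite /lhs /rhs big_setU1 //= !sum_e !sum_x (negPf sS0) (negPf sS1) x_s.
  rewrite subr0 !addr0 add0r => -[->|->]; first by rewrite subrr mulr0 add0r mulrC.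
  have -> : (k.-1)%:R = k%:R - 1 :> R by rewrite -(natrB _ k0) subn1.
  by rewrite /rho (mulrC (a 0 s)); ring.
(* Each index [i] has complemented part [e i], completed by [x_s = k] if [i = s], by a maximizer of
   [eta (- a_i)] if [i] is in [S1], and by a unit vector with a maximizer of [zeta (a_i)] at [s] if
   [i] is in [S0]. A maximizer for [eta] is uncontrolled on [S0], hence the restriction in the last
   clause. *)
have points i : exists x : 'I_n -> nat,
    [/\ forall j, (x j <= mu j)%N, lhs x (e i) = rhs x (e i), i = s -> x s = k &
        i \notin S1 -> forall j, j \in S0 -> x j = e i j].
  have [->|is_] := eqVneq i s.
    exists (x_ k s); split=> //; [exact: x_mu | by apply: tight_s; left | ].
    by move=> _ j /x_S0.
  have [iS1|iS1] := boolP (i \in S1).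
    have [x xmu xE] := @eta_eq _ _ g a mu s S0 k (- a 0 i).
    exists x; split=> //; last by move/eqP: is_.
    rewrite /lhs /rhs !sum_e iS1 /et xE [- a 0 i + _]addrC; ring.
  have iS0 : i \in S0 by move: iS1; rewrite notS1 !inE (negPf is_).
  have [t tmu tE] := @zeta_eq _ _ g a mu s k (a 0 i).
  exists (x_ t i); split=> //; [exact: x_mu | | by move/eqP: is_ | by move=> _ j /x_S0].
  rewrite /lhs /rhs big_setU1 //= !sum_e !sum_x iS0 (negPf iS1) x_s /zt tE.
  by rewrite subr0 addr0 [_ + a 0 i]addrC; ring.
have [x xP] := fin_all_exists points.
pose x0 := x_ k.-1 s; pose X0 := cpl x0 (e s); pose X i := cpl (x i) (e i).
have x0mu j : (x0 j <= mu j)%N by apply: x_mu; rewrite (leq_trans (leq_pred k)).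
pose w (j : 'I_n.+1) := oapp (fun i => lhs (x i) (e i)) (lhs x0 (e s)) (unlift ord0 j).
have sS1N i : i \in S0 -> i \notin S1 by move=> iS0; rewrite (disjointFr dis iS0).
(* The point off the hyperplane lies one unit below the tight point built on [x0]. *)
apply: (@facet_defining_convex_hull _ _ b0 b _
  (fun j => (w j, \row_i (oapp X X0 (unlift ord0 j) i)%:R))
  (lhs x0 (e s) - 1, \row_i (X0 i)%:R)).
- move=> [v z] [/= vf z_mu].
  pose y i := Num.truncn (z 0 i).
  have zE i : z 0 i = (y i)%:R.
    by case: (z_mu i) => zi /andP[z0 _]; rewrite truncnK // natrEint zi.
  have ymu i : (y i <= mu i)%N.
    by case: (z_mu i) => _ /andP[_]; rewrite zE ler_nat.
  pose y' i := (mu i - y i)%N.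
  have cplE i : cpl y y' i = y i by rewrite /cpl /y'; case: ifP => // _; rewrite subKn.
  have y'mu i : i \in S1 -> (y' i <= mu i)%N by move=> _; exact: leq_subr.
  have -> : z = \row_i (cpl y y' i)%:R by apply/rowP => i; rewrite mxE cplE zE.
  rewrite L_cpl //; apply: le_trans (lhs_le y y' ymu); rewrite -f_cpl //.
  by rewrite (eq_bigr (fun i => a 0 i * z 0 i)) // => i _; rewrite cplE zE.
- move=> j; rewrite /w; case: (unlift _ j) => [i|] /=; apply: mixed => //.
  by case: (xP i).
- move=> j /=; rewrite /w; case: (unlift _ j) => [i|] /=; rewrite L_cpl //.
    by case: (xP i).
  by apply: tight_s; right.
- apply: (triangular_affinely_independent sS0 sS1 cover k0 (mu := mu)).
  + by rewrite /X0 /cpl (negPf sS1) /x0 x_s.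
  + move=> j jS0; rewrite /X0 /cpl (negPf (sS1N _ jS0)) /x0 x_S0 // /e.
    by case: eqP => // sj; rewrite -sj (negPf sS0) in jS0.
  + move=> j jS1; rewrite /X0 /cpl jS1 /e; case: eqP => [sj|_]; last by rewrite subn0.
    by rewrite -sj (negPf sS1) in jS1.
  + by rewrite /X /cpl (negPf sS1); case: (xP s) => _ _ ->.
  + move=> j jS0; rewrite /X /cpl (negPf (sS1N _ jS0)).
    case: (xP s) => _ _ _ -> //; rewrite /e.
    by case: eqP => // sj; rewrite -sj (negPf sS0) in jS0.
  + by move=> i j jS1 ij; rewrite /X /cpl jS1 /e (negPf ij) subn0.
  + by move=> j jS1; rewrite /X /cpl jS1 /e eqxx subn1 prednK.
  + move=> i j iS0 jS0; rewrite /X /cpl (negPf (sS1N _ jS0)).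
    by case: (xP i) => _ _ _ ->; rewrite ?sS1N.
- by apply: mixed => //; rewrite gerBl.
- rewrite /= L_cpl // -tight_s; last by right.
  by rewrite eq_sym -subr_eq0 opprB addrC subrK oner_eq0.
Qed.
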